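(* Let $n\ge 1$. The Walsh algebra $\mathcal W$ (of dimension $2^n$ over $\mathbb R$) is polynomial and semisimple, being the direct sum of $2^n$ algebras isomorphic to the real field $\mathbb R$.
   Context: The Walsh algebra is $\mathcal W=U_0\otimes U_1\otimes\cdots\otimes U_{n-1}$, the tensor product over $\mathbb R$ (called ''direct product'' in the paper) of $n$ two-dimensional commutative associative unital real algebras $U_k$ with bases $\{\widehat 1_k,\widehat u_k\}$, where $\widehat 1_k$ is the unit and $\widehat u_k^2=\widehat 1_k$. A commutative, associative, unital real algebra of finite dimension $N$ is called polynomial if it contains an element $v$ such that $\{v^0,v,\ldots,v^{N-1}\}$ is a basis, i.e. if it is isomorphic to $\mathbb R[X]/(P)$ for some $P\in\mathbb R[X]$ of degree $N$. *)

(* Defs.v *)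
From mathcomp Require Import all_boot all_order all_algebra all_field.
From mathcomp Require Export reals.

Set Implicit Arguments.
Unset Strict Implicit.
Unset Printing Implicit Defensive.

Import GRing.Theory.
Local Open Scope ring_scope.

Section TensorProduct.
Variables (K : fieldType) (n : nat).

(* [dfwith x y] is the family x with its i-th entry replaced by y : U i. *)
Definition multilinear (U : 'I_n -> lmodType K) (V : lmodType K)
    (f : (forall i, U i) -> V) : Prop :=
  forall (x : forall i, U i) (i : 'I_n) (a : K) (y z : U i),
    f (dfwith x (a *: y + z)) = a *: f (dfwith x y) + f (dfwith x z).

(* W is the tensor product over K of the algebras U_0, ..., U_(n-1), with
   t x = x_0 (x) ... (x) x_(n-1): the vector space W is determined by the
   universal property of t among multilinear maps, and its product by
   componentwise multiplication of pure tensors. *)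
Record is_tensor_product (U : 'I_n -> falgType K) (W : falgType K)
    (t : (forall i, U i) -> W) : Prop := IsTensorProduct {
  tensor_multilinear : multilinear t;
  tensor_factor : forall (V : lmodType K) (f : (forall i, U i) -> V),
    multilinear f -> exists g : {linear W -> V}, forall x, g (t x) = f x;
  tensor_factor_unique : forall (V : lmodType K) (g h : {linear W -> V}),
    (forall x, g (t x) = h (t x)) -> forall w, g w = h w;
  tensor_one : t (fun i => 1) = 1;
  tensor_mul : forall x y, t (fun i => x i * y i) = t x * t y }.

End TensorProduct.

Section Algebras.
Variables (K : fieldType) (A : falgType K).

Definition polynomial_algebra : Prop :=
  (forall x y : A, x * y = y * x) /\
  exists v : A, basis_of {:A} [seq v ^+ i | i <- iota 0 (\dim {:A})].

Definition left_ideal (I : {vspace A}) : Prop := ({:A} * I <= I)%VS.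

Definition minimal_left_ideal (I : {vspace A}) : Prop :=
  [/\ left_ideal I, I <> 0%VS
    & forall J, left_ideal J -> (J <= I)%VS -> J = 0%VS \/ J = I].

(* A is semisimple as a left module over itself. Left ideals are K-subspaces
   because A is unital, and A is finite-dimensional, so finite direct sums of
   subspaces suffice. *)
Definition semisimple_algebra : Prop :=
  exists (m : nat) (I : 'I_m -> {vspace A}),
    [/\ forall i, minimal_left_ideal (I i),
        directv (\sum_i I i)%VS & (\sum_i I i)%VS = fullv].

End Algebras.

Definition isomorphic_algebras (K : fieldType) (A B : algType K) : Prop :=
  exists f : {lrmorphism A -> B}, bijective f.

(* The external direct sum: componentwise operations on finite families. *)
Definition is_direct_sum (K : fieldType) (m : nat) (A : 'I_m -> algType K)
    (W : algType K) : Prop :=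
  exists p : forall i, {lrmorphism W -> A i},
    bijective (fun (w : W) (i : 'I_m) => p i w).

(* Main.v *)
Require Import Defs.
From HB Require Import structures.
From mathcomp Require Import all_boot all_order all_algebra all_field.
From mathcomp Require Import boolp reals.

Set Implicit Arguments.
Unset Strict Implicit.
Unset Printing Implicit Defensive.

Import GRing.Theory Num.Theory.
Local Open Scope ring_scope.

(** Each factor has the two eigenvectors [(1 + u k) / 2] and [(1 - u k) / 2]
    of multiplication by [u k]. They are orthogonal idempotents and span [U k],
    so the [2 ^ n] pure tensors of such vectors, one for each choice of signs,
    multiply as orthogonal idempotents of [W]. They span [W] because pure
    tensors do ([tensor_span]), and none of them vanishes because a pure tensor
    of nonzero vectors is detected by a product of coordinate functionals
    ([pure_tensor_neq0]).

    Nonzero orthogonal idempotents that span an algebra form a basis of it, in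
    which the product is computed coordinate by coordinate; each coordinate is
    thus an algebra morphism to the scalars, and together they are the
    isomorphism with the direct sum ([split_direct_sum]). Left multiplication
    scales each idempotent, so the lines they span are minimal left ideals
    ([split_semisimple]). An element whose coordinates are pairwise distinct
    generates the algebra, since a polynomial that kills it has all those
    coordinates as roots ([split_polynomial]). *)

(** * Algebras spanned by nonzero orthogonal idempotents *)

Section SplitAlgebra.
Variables (K : fieldType) (A : falgType K) (m : nat) (e : 'I_m -> A).
Hypothesis e_orth : forall i j, e i * e j = e i *+ (i == j).
Hypothesis e_neq0 : forall i, e i != 0.

Let X := [tuple e i | i < m].

Let X_nth (i : 'I_m) : X`_i = e i.
Proof. by rewrite -tnth_nth tnth_mktuple. Qed.

(** Multiplying a linear relation by [e i] isolates its [i]-th coefficient. *)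
Lemma orthogonal_idempotents_free : free X.
Proof.
apply/freeP => c sum0 i; apply/eqP.
have /eqP : e i * \sum_j c j *: X`_j = 0 by rewrite sum0 mulr0.
rewrite mulr_sumr (bigD1 i) //= big1 ?addr0 => [|j /negPf ji]; last first.
  by rewrite X_nth -scalerAr e_orth eq_sym ji scaler0.
by rewrite X_nth -scalerAr e_orth eqxx scaler_eq0 (negPf (e_neq0 i)) orbF.
Qed.

Hypothesis e_span : forall w, w \in <<X>>%VS.

Lemma idempotents_basis : basis_of {:A} X.
Proof.
rewrite /basis_of orthogonal_idempotents_free andbT.
by apply/eqP/vspaceP => w; rewrite memvf e_span.
Qed.

Lemma dim_split : \dim {:A} = m.
Proof. exact: size_basis idempotents_basis. Qed.

Local Notation coef := (coord X).

Lemma coef_expansion w : w = \sum_i coef i w *: e i.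
Proof.
by rewrite {1}(coord_span (e_span w)); apply: eq_bigr => i _; rewrite X_nth.
Qed.

Lemma coef_sum (c : 'I_m -> K) j : coef j (\sum_i c i *: e i) = c j.
Proof.
under eq_bigr do rewrite -X_nth.
exact/coord_sum_free/orthogonal_idempotents_free.
Qed.

Lemma coef_inj w w' : (forall i, coef i w = coef i w') -> w = w'.
Proof.
move=> eqc; rewrite (coef_expansion w) (coef_expansion w').
by apply: eq_bigr => i _; rewrite eqc.
Qed.

(** Multiplicativity of the coordinates and minimality of the lines spanned by
    the idempotents both come from this eigenvector equation. *)
Lemma mul_idempotent w j : w * e j = coef j w *: e j.
Proof.
rewrite {1}(coef_expansion w) mulr_suml (bigD1 j) //=.
rewrite big1 ?addr0 => [|i /negPf ij].
  by rewrite -scalerAl e_orth eqxx.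
by rewrite -scalerAl e_orth ij scaler0.
Qed.

Lemma coefM j : {morph coef j : w w' / w * w'}.
Proof.
move=> w w'; apply/eqP; rewrite -subr_eq0.
have : (coef j (w * w') - coef j w * coef j w') *: e j == 0.
  rewrite scalerBl -mul_idempotent -mulrA (mul_idempotent w').
  by rewrite -scalerAr mul_idempotent scalerA mulrC subrr.
by rewrite scaler_eq0 (negPf (e_neq0 j)) orbF.
Qed.

Lemma coef1 j : coef j 1 = 1.
Proof.
apply/eqP; rewrite -subr_eq0.
have : (coef j 1 - 1) *: e j == 0.
  by rewrite scalerBl -mul_idempotent mul1r scale1r subrr.
by rewrite scaler_eq0 (negPf (e_neq0 j)) orbF.
Qed.

Lemma coef_lrmorphism j : exists f : {lrmorphism A -> K^o}, f =1 coef j.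
Proof.
pose g : A -> K^o := coef j.
have g_linear : linear g by move=> a x y; rewrite /g linearP.
have g_monoid : monoid_morphism g by split; [exact: coef1|exact: coefM].
pose lM := GRing.isLinear.Build K A K^o *:%R g g_linear.
pose mM := GRing.isMonoidMorphism.Build A K^o g g_monoid.
pose f : {lrmorphism A -> K^o} := HB.pack g lM mM.
by exists f.
Qed.

(** The inverse of the map to the coordinates sends a family [c] to
    [\sum_i c i *: e i]. *)
Lemma split_direct_sum : is_direct_sum (fun _ : 'I_m => K^o : algType K) A.
Proof.
have [p pE] := choice coef_lrmorphism.
exists p; exists (fun c => \sum_i c i *: e i) => [w|c].
  by rewrite [RHS]coef_expansion; apply: eq_bigr => i _; rewrite pE.
by apply/funext => j; rewrite pE coef_sum.
Qed.

Lemma splitC (w w' : A) : w * w' = w' * w.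
Proof. by apply: coef_inj => i; rewrite !coefM mulrC. Qed.

Lemma coefX j w k : coef j (w ^+ k) = coef j w ^+ k.
Proof. by elim: k => [|k IHk]; rewrite ?coef1 // !exprS coefM IHk. Qed.

(** The generator is [v = \sum_i a i *: e i]. A linear relation between the
    powers [v ^+ k], [k < m], is a polynomial of size at most [m]; its [j]-th
    coordinate says that [a j] is a root, which gives [m] distinct roots. *)
Lemma split_polynomial (a : 'I_m -> K) : injective a -> polynomial_algebra A.
Proof.
move=> a_inj; split; first exact: splitC.
pose v := \sum_i a i *: e i; exists v; rewrite dim_split.
have defY : [seq v ^+ k | k <- iota 0 m] = [tuple v ^+ k | k < m].
  by rewrite /= -val_enum_ord -map_comp.
rewrite basisEfree subvf size_map size_iota dim_split leqnn !andbT defY.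
have Y_nth (k : 'I_m) : [tuple v ^+ k | k < m]`_k = v ^+ k.
  by rewrite -tnth_nth tnth_mktuple.
apply/freeP => c; under eq_bigr do rewrite Y_nth; move=> sum0 i.
(* The coefficients are indexed by ordinals; [c'] extends them by zero. *)
pose c' k := if insub k is Some k' then c k' else 0.
pose q := \poly_(k < m) c' k.
suff q0 : q = 0.
  by have := coef_poly m c' i; rewrite -/q q0 coef0 ltn_ord /c' valK.
apply/eqP; apply: contraTT (leqnn m) => q_neq0; rewrite -ltnNge.
apply: leq_trans (size_poly m c').
rewrite -{1}(size_enum_ord m) -(size_map a).
apply: max_poly_roots => //; last by rewrite map_inj_uniq ?enum_uniq.
apply/allP => _ /mapP[j _ ->]; apply/rootP.
rewrite horner_poly -[RHS](linear0 (coef j)) -[in RHS]sum0 linear_sum /=.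
apply: eq_bigr => k _.
by rewrite /c' valK linearZ /= coefX coef_sum.
Qed.

(** The line [<[e i]>] is an ideal by the eigenvector equation, and has no
    proper nonzero subspace at all. *)
Lemma idempotent_minimal_left_ideal i : minimal_left_ideal <[e i]>%VS.
Proof.
split.
- apply/prodvP => w _ _ /vlineP[c ->].
  by rewrite -scalerAr mul_idempotent !memvZ ?memv_line.
- by move/eqP; rewrite -dimv_eq0 dim_vline e_neq0.
- move=> J _ sJ; have [->|J_neq0] := eqVneq J 0%VS; [by left|right].
  by apply/eqP; rewrite eqEdim sJ dim_vline e_neq0 lt0n dimv_eq0.
Qed.

Lemma split_semisimple : semisimple_algebra A.
Proof.
have sumE : (\sum_i <[e i]>)%VS = <<X>>%VS.
  by rewrite span_def big_map big_enum.
exists m, (fun i => <[e i]>%VS); split.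
- exact: idempotent_minimal_left_ideal.
- rewrite directvE /= sumE (eqnP orthogonal_idempotents_free) size_tuple.
  by under eq_bigr do rewrite dim_vline e_neq0; rewrite sum1_card card_ord.
- by rewrite sumE (span_basis idempotents_basis).
Qed.

End SplitAlgebra.

(** * Pure tensors *)

Section PureTensors.
Variables (K : fieldType) (n : nat) (U : 'I_n -> falgType K).

Lemma dfwith_id (x : forall k, U k) i : dfwith x (x i) = x.
Proof. by apply: functional_extensionality_dep => j; case: dfwithP. Qed.

(** Linearity in the [i]-th entry is used in the form
    [f (-1 *: 0 + 0) = - f 0 + f 0]. *)
Lemma multilinear0 (V : lmodType K) (f : (forall k, U k) -> V) x i :
  multilinear f -> x i = 0 -> f x = 0.
Proof.
move=> f_lin xi0; have := f_lin x i (-1) (x i) (x i).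
by rewrite xi0 scaler0 addr0 -xi0 dfwith_id scaleN1r addNr.
Qed.

Variables (W : falgType K) (t : (forall k, U k) -> W).
Hypothesis W_tensor : is_tensor_product t.

(** The projection onto [S] and the identity agree on pure tensors, hence are
    equal by the uniqueness part of the universal property. *)
Lemma subspace_of_pure_tensors (S : {vspace W}) :
  (forall x, t x \in S) -> forall w, w \in S.
Proof.
move=> tS w.
have /(_ w) <- : forall w, projv S w = w; last exact: memv_proj.
apply: (tensor_factor_unique W_tensor (g := projv S) (h := idfun)) => x /=.
by rewrite projv_id.
Qed.

(** By multilinearity, entries can be freed one at a time from the constraint
    of lying in the spanning families [B k]. *)
Lemma tensor_span (B : forall k, seq (U k)) (S : {vspace W}) :
    (forall k, <<B k>>%VS = fullv) ->
    (forall x, (forall k, x k \in B k) -> t x \in S) ->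
  forall w, w \in S.
Proof.
move=> B_span S_B; apply: subspace_of_pure_tensors => x.
(* Entries of index below [m] are arbitrary, the others lie in [B]. *)
suff: forall m y, (forall k : 'I_n, (m <= k)%N -> y k \in B k) -> t y \in S.
  by move/(_ n); apply=> k; rewrite leqNgt ltn_ord.
elim=> [|m IHm] {}x xB; first by apply: S_B => k; apply: xB.
have [lt_mn|le_nm] := ltnP m n; last first.
  by apply: IHm => k /(leq_trans le_nm); rewrite leqNgt ltn_ord.
pose i := Ordinal lt_mn.
have S_lin a y z : t (dfwith x (y : U i)) \in S -> t (dfwith x z) \in S ->
    t (dfwith x (a *: y + z)) \in S.
  by move=> yS zS; rewrite (tensor_multilinear W_tensor) memvD ?memvZ.
rewrite -(dfwith_id x i).
have : x i \in <<in_tuple (B i)>>%VS by rewrite B_span memvf.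
move/coord_span->.
elim/big_rec: _ => [|j y _ yS].
  rewrite (multilinear0 (i := i) (tensor_multilinear W_tensor)) ?mem0v //.
  by rewrite dfwith_in.
apply: S_lin => //; apply: IHm => k le_mk.
case: dfwithP le_mk => [_|{}k ik le_mk]; first exact: mem_nth.
apply: xB; rewrite ltn_neqAle le_mk andbT.
by apply: contraNneq ik => mk; apply/eqP/val_inj.
Qed.

Lemma prod_multilinear (phi : forall k, {scalar U k}) :
  multilinear (fun x => \prod_k phi k (x k) : K^o).
Proof.
move=> x i a y z; rewrite !(bigD1 (P := predT) i) //= !dfwith_in linearP /=.
have dfw w : \prod_(k | k != i) phi k (dfwith x (w : U i) k)
           = \prod_(k | k != i) phi k (x k).
  by apply: eq_bigr => k ki; rewrite dfwith_out // eq_sym.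
by rewrite !dfw mulrDl -mulrA.
Qed.

(** For each [k] some coordinate of [x k] in a basis of [U k] is nonzero; the
    product of these coordinate functionals factors through [t] and takes a
    nonzero value at [x]. *)
Lemma pure_tensor_neq0 (x : forall k, U k) : (forall k, x k != 0) -> t x != 0.
Proof.
move=> x_neq0.
have coord_neq0 k : {i | coord (vbasis {:U k}) i (x k) != 0}.
  apply: sigW; apply/existsP; apply: contraNT (x_neq0 k) => /existsPn xk0.
  rewrite (coord_vbasis (memvf (x k))) big1 // => i _.
  by move/negPn/eqP: (xk0 i) => ->; rewrite scale0r.
pose phi k : {scalar U k} := coord (vbasis {:U k}) (sval (coord_neq0 k)).
have [g gE] := tensor_factor W_tensor (prod_multilinear phi).
apply/eqP => tx0; have := gE x; rewrite tx0 linear0 => /esym/eqP.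
by apply/negP/prodf_neq0 => k _; apply: (svalP (coord_neq0 k)).
Qed.

End PureTensors.

(** * The algebra generated by an involution *)

Section Involution.
Variables (K : fieldType) (A : falgType K) (u : A).
Hypothesis two_neq0 : 2%:R != 0 :> K.
Hypothesis u_sq : u ^+ 2 = 1.

(** Multiplication by this element is the projector onto the eigenspace of
    multiplication by [u] for the eigenvalue [(-1) ^+ b]. *)
Definition spectral_idempotent (b : bool) : A :=
  2%:R^-1 *: (1 + (-1) ^+ b *: u).

Lemma mul_spectral_idempotent b :
  u * spectral_idempotent b = (-1) ^+ b *: spectral_idempotent b.
Proof.
rewrite /spectral_idempotent -scalerAr mulrDr mulr1 -scalerAr -expr2 u_sq.
rewrite scalerA mulrC -scalerA; congr (_ *: _).
by rewrite scalerDr scalerA -expr2 sqrr_sign scale1r addrC.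
Qed.

Lemma spectral_idempotent_orth b c :
  spectral_idempotent b * spectral_idempotent c
  = spectral_idempotent b *+ (b == c).
Proof.
rewrite {1}/spectral_idempotent -scalerAl mulrDl mul1r -scalerAl.
rewrite mul_spectral_idempotent scalerA -signr_addb.
case: eqP => [->|/eqP neq_bc]; last first.
  have -> : b (+) c = true by case: b c neq_bc => [] [].
  by rewrite expr1 scaleN1r subrr scaler0.
rewrite addbb expr0 scale1r mulr1n -mulr2n -scaler_nat scalerA.
by rewrite mulVf // scale1r.
Qed.

Lemma spectral_idempotent_neq0 b :
  free [:: 1; u] -> spectral_idempotent b != 0.
Proof.
rewrite free_cons span_seq1 => /andP[/negP u'1 _].
rewrite scaler_eq0 invr_eq0 (negPf two_neq0) /= addr_eq0 -scaleNr.
by apply/eqP => u1; apply: u'1; apply/vlineP; exists (- (-1) ^+ b).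
Qed.

(** The idempotents have sum [1] and difference [u]. *)
Lemma spectral_idempotent_span :
  <<[:: 1%R; u]>>%VS = fullv ->
  <<codom spectral_idempotent>>%VS = fullv.
Proof.
move=> span_u; apply/eqP; rewrite eqEsubv subvf -span_u.
have mem_e b : spectral_idempotent b \in <<codom spectral_idempotent>>%VS.
  exact/memv_span/codom_f.
have half2 (x : A) : 2%:R^-1 *: x + 2%:R^-1 *: x = x.
  by rewrite -mulr2n -scaler_nat scalerA mulfV // scale1r.
have eD : spectral_idempotent false + spectral_idempotent true = 1.
  rewrite -scalerDr expr0 expr1 scale1r scaleN1r addrACA subrr addr0.
  by rewrite scalerDr half2.
have eB : spectral_idempotent false - spectral_idempotent true = u.
  rewrite -scalerBr expr0 expr1 scale1r scaleN1r opprD opprK addrACA subrr add0r.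
  by rewrite scalerDr half2.
apply/span_subvP => x; rewrite !inE => /orP[] /eqP->.
  by rewrite -eD memvD.
by rewrite -eB memvB.
Qed.

End Involution.

(** * The Walsh algebra *)

Theorem mainTheorem4 (R : realType) (n : nat) (n_ge1 : (1 <= n)%N)
    (U : 'I_n -> falgType R)
    (U_comm : forall k (x y : U k), x * y = y * x)
    (u : forall k, U k)
    (U_basis : forall k, basis_of {:U k} [:: 1; u k])
    (u_sq : forall k, u k ^+ 2 = 1)
    (W : falgType R) (t : (forall k, U k) -> W)
    (W_tensor : is_tensor_product t) :
  [/\ \dim {:W} = (2 ^ n)%N,
      polynomial_algebra W,
      semisimple_algebra W
    & exists A : 'I_(2 ^ n) -> algType R,
        (forall i, isomorphic_algebras (A i) R^o) /\ is_direct_sum A W].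
Proof.
have two_neq0 : 2%:R != 0 :> R by rewrite pnatr_eq0.
have card_signs : #|{: {ffun 'I_n -> bool}}| = (2 ^ n)%N.
  by rewrite card_ffun card_bool card_ord.
pose eU k b := spectral_idempotent (u k) b.
(* An enumeration of the sign vectors by the index set of the statement. *)
pose sign (i : 'I_(2 ^ n)) := enum_val (cast_ord (esym card_signs) i).
have sign_inj : injective sign by move=> i j /enum_val_inj/cast_ord_inj.
pose e i := t (fun k => eU k (sign i k)).
have e_orth i j : e i * e j = e i *+ (i == j).
  rewrite -(tensor_mul W_tensor); have [<-|neq_ij] := eqVneq i j.
    rewrite mulr1n; congr t; apply: functional_extensionality_dep => k.
    by rewrite spectral_idempotent_orth // eqxx.
  (* Two distinct sign vectors differ at some [k], where the product of the
     two entries is zero. *)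
  have [k neq_k] : exists k, sign i k != sign j k.
    apply/existsP; apply: contraNT neq_ij => /existsPn eq_s.
    by apply/eqP/sign_inj/ffunP => k; apply/eqP/negPn/eq_s.
  apply: (multilinear0 (i := k)) (tensor_multilinear W_tensor) _.
  by rewrite spectral_idempotent_orth // (negPf neq_k).
have e_neq0 i : e i != 0.
  apply: (pure_tensor_neq0 W_tensor) => k.
  exact/spectral_idempotent_neq0/(basis_free (U_basis k)).
have e_span w : w \in <<[tuple e i | i < 2 ^ n]>>%VS.
  apply: (tensor_span W_tensor (B := fun k => codom (eU k))) => [k|x xB].
    by apply: spectral_idempotent_span; rewrite ?(span_basis (U_basis k)).
  have [s sE] : exists s : {ffun 'I_n -> bool}, forall k, x k = eU k (s k).
    have s_ k : {b | x k == eU k b}.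
      by apply: sigW; have /codomP[b ->] := xB k; exists b.
    exists [ffun k => sval (s_ k)] => k; rewrite ffunE.
    exact/eqP/(svalP (s_ k)).
  have -> : t x = e (cast_ord card_signs (enum_rank s)).
    congr t; apply: functional_extensionality_dep => k.
    by rewrite sE /sign cast_ordK enum_rankK.
  by apply: memv_span; apply: map_f; rewrite mem_enum.
split.
- exact: dim_split e_orth e_neq0 e_span.
- apply: (split_polynomial e_orth e_neq0 e_span (a := fun i => (i : nat)%:R)).
  by move=> i j /eqP; rewrite eqr_nat => /eqP/val_inj.
- exact: split_semisimple e_orth e_neq0 e_span.
- exists (fun=> R^o : algType R); split; last first.
    exact: split_direct_sum e_orth e_neq0 e_span.
  by move=> _; exists idfun; exists idfun.
Qed.
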